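(* There is no semi-online $k$-colouring algorithm from the left or from below for increasing steps. More precisely, for any positive integers $k$ and $m$, there is no semi-online algorithm to $k$-colour bottomless rectangles presented from the left, and there is none to $k$-colour bottomless rectangles presented from below, so that (for every finite family) at every step, any point covered by increasing $m$-steps is covered by at least $2$ colours. Similarly, for any positive integers $k$ and $m$, there is no semi-online algorithm to $k$-colour bottomless rectangles presented from the right, and none for rectangles presented from below, so that (for every finite family) at every step, any point covered by decreasing $m$-steps is covered by at least $2$ colours.
   Context: A (closed) bottomless rectangle is a subset of $\mathbb{R}^2$ of the form $\{(x,y): l\le x\le r,\ y\le t\}$, denoted by its parameters $(l,r,t)$; $l$ is its left-coordinate, $r$ its right-coordinate and $t$ its height. Bottomless rectangles $R_i=(l_i,r_i,t_i)$, $i=1,\dots,m$, with a common point and with $l_1<\dots<l_m$ and $r_1<\dots<r_m$ form increasing $m$-steps if $t_1<\dots<t_m$, and decreasing $m$-steps if $t_1>\dots>t_m$. A point is covered by such $m$-steps if it lies in all of $R_1,\dots,R_m$. Presenting rectangles from below means in increasing order of height; from the left means in increasing order of left-coordinate; from the right means in decreasing order of right-coordinate. A semi-online $k$-colouring algorithm receives the rectangles one by one in the given order, without knowledge of the rectangles still to come. After each new rectangle it may assign one of $k$ colours to any of the so far presented, not yet coloured rectangles (it may leave rectangles uncoloured and colour them later); colours are irrevocable. So after every step there is a partial $k$-colouring of the presented rectangles, determined by the sequence presented so far, and each partial colouring extends the previous one. The required condition refers, at each step, to the rectangles presented so far and their current partial colouring: a point is covered by a colour if it lies in a presented rectangle that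 currently has that colour; uncoloured rectangles contribute no colour. *)

(* Defs.v *)
From HB Require Import structures.
From mathcomp Require Import all_boot all_order all_algebra.
From mathcomp Require Import boolp classical_sets reals.

Set Implicit Arguments.
Unset Strict Implicit.
Unset Printing Implicit Defensive.

Import Order.TTheory GRing.Theory Num.Theory.
Local Open Scope ring_scope.
Local Open Scope classical_set_scope.

Record rectangle (R : realType) := Rectangle {
  leftc : R;
  rightc : R;
  height : R;
  leftc_le_rightc : leftc <= rightc }.

HB.instance Definition _ (R : realType) := gen_eqMixin (rectangle R).

Section BottomlessRectangles.
Variable R : realType.
Implicit Types (s : seq (rectangle R)) (A B : rectangle R) (p : R * R).

Definition region A : set (R * R) :=
  [set p | leftc A <= p.1 <= rightc A /\ p.2 <= height A].

(* [hlt] is the order in which the heights are listed: [<] for increasing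
   steps and [>] for decreasing steps. *)
Definition steps (hlt : rel R) (m : nat) (S : 'I_m -> rectangle R) : Prop :=
  (exists p, forall i, region (S i) p) /\
  forall i j : 'I_m, (i < j)%N ->
    [/\ leftc (S i) < leftc (S j),
        rightc (S i) < rightc (S j) &
        hlt (height (S i)) (height (S j))].

Definition increasing_steps := steps (fun a b => a < b).
Definition decreasing_steps := steps (fun a b => a > b).

(* A finite family is given by the sequence in which it is presented. The
   orders are strict, so that the family determines the sequence and has no
   repetitions. Allowing ties would only put more demands on an algorithm,
   so excluding them makes the non-existence of an algorithm no weaker. *)
Definition from_left s : bool := sorted (fun A B => leftc A < leftc B) s.
Definition from_right s : bool := sorted (fun A B => rightc A > rightc B) s.
Definition from_below s : bool := sorted (fun A B => height A < height B) s.

(* [a s A] is the colour of [A] once exactly the rectangles of [s] have been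
   presented, in that order, and [None] if [A] is then still uncoloured.
   Only its values at members [A] of [s] are ever used. *)
Definition algorithm (k : nat) := seq (rectangle R) -> rectangle R -> option 'I_k.

Definition semi_online (k : nat) (presented : pred (seq (rectangle R)))
    (a : algorithm k) : Prop :=
  forall s B, presented (rcons s B) ->
  forall A (c : 'I_k), A \in s -> a s A = Some c -> a (rcons s B) A = Some c.

Definition covered_by_colour (k : nat) s (chi : rectangle R -> option 'I_k)
    (c : 'I_k) p : Prop :=
  exists A, [/\ A \in s, chi A = Some c & region A p].

Definition covered_by_two_colours (k : nat) s
    (chi : rectangle R -> option 'I_k) p : Prop :=
  exists c d : 'I_k,
    [/\ c != d, covered_by_colour s chi c p & covered_by_colour s chi d p].

Definition covered_by_steps (m : nat)
    (is_steps : ('I_m -> rectangle R) -> Prop) s p : Prop :=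
  exists S : 'I_m -> rectangle R,
    [/\ is_steps S, forall i, S i \in s & forall i, region (S i) p].

(* The state after the [n]-th step consists of the first [n] rectangles and
   their current partial colouring. *)
Definition colours_steps (k m : nat) (presented : pred (seq (rectangle R)))
    (is_steps : ('I_m -> rectangle R) -> Prop) (a : algorithm k) : Prop :=
  forall s, presented s -> forall n, (n <= size s)%N ->
  forall p, covered_by_steps is_steps (take n s) p ->
    covered_by_two_colours (take n s) (a (take n s)) p.

Definition has_semi_online_algorithm (k m : nat)
    (presented : pred (seq (rectangle R)))
    (is_steps : ('I_m -> rectangle R) -> Prop) : Prop :=
  exists a : algorithm k,
    semi_online presented a /\ colours_steps presented is_steps a.

End BottomlessRectangles.

(* Main.v *)
Require Import Defs.
From mathcomp Require Import all_boot all_order all_algebra.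
From mathcomp Require Import boolp classical_sets reals.
From mathcomp Require Import zify.

(** The proof is a strategy against an arbitrary algorithm. All rectangles used
    have their left side in [-1, 0) and their right side at a positive
    abscissa, and both left-coordinates and heights increase with time. They are
    therefore presented from the left and from below at once, and the only
    choice left to the adversary is the right-coordinate, that is, an integer
    value per rectangle. The upper right corner of a rectangle is then covered
    exactly by the rectangles that are at least as late and have at least as
    large a value. A history of the game is a sequence of integers.

    Say that a history [y] is a child of [x] ([child]) when it is obtained from
    [x] by adding values below everything in [x], and finally one value above
    the last value of [x]. Along a chain of such histories the newest
    rectangles form increasing steps, and no other rectangle covers the corner
    of the first of them ([dominating_index]). So it suffices to find a chain
    of length [m] whose newest rectangles carry at most one colour at the end.

    If colours were given at once, a single edge of [child] with equal colours
    at its ends would be the issue, and it exists for every finite colouring of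
    the histories ([unbounded_chromatic_child]): in a situation where the set of
    colours that the algorithm may still use has stopped shrinking, present one
    exposed rectangle of each of these colours, and then a rectangle above all
    of them, whose colour must be repeated.

    A semi-online algorithm may delay its decisions. What it does along a chain
    of [m] histories is still one of finitely many patterns, fixed when the
    chain is complete. As for shift graphs, having no proper finite colouring
    passes from the edge relation to windows of any length: some chain has two
    consecutive windows with the same pattern ([equal_consecutive_windows]).
    The colour of the [i]-th rectangle at time [j] then depends on [j - i] only,
    and since colours are irrevocable, all coloured rectangles of the chain
    have the same colour ([monochromatic_chain]).

    Decreasing steps follow by reflecting the plane in a vertical line. *)

Set Implicit Arguments.
Unset Strict Implicit.
Unset Printing Implicit Defensive.

Import Order.TTheory GRing.Theory Num.Theory.
Local Open Scope ring_scope.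

Implicit Types (s t : seq int) (u v : int).

(** * Repeated patterns along paths of a digraph *)

(** A digraph with this property has no proper colouring with finitely many
    colours. *)
Definition unbounded_chromatic (T : Type) (e : rel T) : Prop :=
  forall (K : finType) (f : T -> K), exists x y, e x y /\ f x = f y.

(** The argument that bounds the chromatic number of shift graphs from below. A
    colouring of paths with [w + 2] vertices induces a colouring of the shorter
    ones: forget the first vertex and keep the set of colours that it can
    produce. If two consecutive short windows get the same set, then the colour
    of their union, which lies in the second set, lies in the first one too, so
    it is also the colour of some path one step further down. *)
Lemma equal_consecutive_windows (T : Type) (e : rel T) :
  unbounded_chromatic e ->
  forall (w : nat) (K : finType) (F : seq T -> K),
  exists x p y,
    [/\ path e x (rcons p y), size p = w & F (x :: p) = F (rcons p y)].
Proof.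
move=> chr_e; elim=> [|w IHw] K F.
  have [x [y [exy Fxy]]] := chr_e K (fun z => F [:: z]).
  by exists x, [::], y; split; rewrite //= exy.
pose G p : {set K} :=
  finset (fun c => `[< exists x, path e x p /\ F (x :: p) = c >]).
have [x [p [y [e_xpy sz_p Gxpy]]]] := IHw _ G.
have : F (x :: rcons p y) \in G (rcons p y).
  by rewrite inE; apply/asboolP; exists x.
rewrite -Gxpy inE => /asboolP[x' [e_x'xp F_x'xp]].
exists x', (x :: p), y; split=> //; last by rewrite /= sz_p.
by case/andP: e_x'xp => /= -> _.
Qed.

(** * Finite colourings of histories *)

(** The values [t] lie below all of [x], rather than just below its last value,
    so that they dominate no corner of a rectangle presented in [x]. *)
Definition next_greater (x y : seq int) : Prop :=
  exists t b, [/\ x != [::], y = x ++ rcons t b, last 0 x < b &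
                  {in x & t, forall v w, w < v}].

Definition child : rel (seq int) := fun x y => `[< next_greater x y >].

Lemma exists_lower_bound (s : seq int) (u : int) :
  exists2 u', u' <= u & all (>= u') s.
Proof.
elim: s => [|v s [u' le_u'u s_ge]]; first by exists u.
exists (Num.min u' v); first by rewrite ge_min le_u'u.
rewrite /= ge_min lexx orbT /=; apply: sub_all s_ge => w /=.
by move=> le_u'w; rewrite ge_min le_u'w.
Qed.

Section OnlineColouring.
Variables (K : finType) (f : seq int -> K).

(** In the state [(s, u)] the history is [s], with all values at least [u], and
    the adversary only plays values below [u] from now on. This leaves room to
    play later a value that exceeds all the new ones and none of the old. *)
Definition reachable (s : seq int) (u : int) : {set K} :=
  finset (fun c => `[< exists t, [/\ t != [::], all (< u) t & f (s ++ t) = c] >]).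

Lemma reachable_sub s t u u' :
  u' <= u -> all (< u) t -> reachable (s ++ t) u' \subset reachable s u.
Proof.
move=> le_u'u t_lt; apply/fintype.subsetP=> c; rewrite !inE.
move=> [t' [t'_n0 t'_lt fc]]; exists (t ++ t'); split.
- by case: t {t_lt fc} => //.
- rewrite all_cat t_lt; apply: sub_all t'_lt => v /= lt_vu'.
  exact: lt_le_trans le_u'u.
- by rewrite catA.
Qed.

Definition stable (s : seq int) (u : int) : Prop :=
  forall t u', u' <= u -> all (< u) t -> all (>= u') (s ++ t) ->
  reachable (s ++ t) u' = reachable s u.

(** Reachable sets only shrink as play goes on, and they are finite, so a state
    with a smallest one is stable. *)
Lemma exists_stable_state : exists s u, all (>= u) s /\ stable s u.
Proof.
pose P n := `[< exists s u, all (>= u) s /\ #|reachable s u| = n >].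
have exP : exists n, P n.
  by exists #|reachable [::] 0|; apply/asboolP; exists [::], 0.
case: (ex_minnP exP) => n /asboolP[s [u [s_ge card_su]]] min_n.
exists s, u; split=> // t u' le_u'u t_lt st_ge.
apply/eqP; rewrite eqEcard reachable_sub //= card_su min_n //.
by apply/asboolP; exists (s ++ t), u'.
Qed.

(** From a stable state any reachable colour can be obtained, again and again,
    in regions that lie lower and lower. Hence all colours of [cs] become
    visible: what comes after the rectangle with colour [c] lies below it and
    below everything that precedes it. *)
Lemma exists_forest s u (cs : seq K) :
  all (>= u) s -> stable s u -> {subset cs <= reachable s u} ->
  exists2 t, all (< u) t &
    {in cs, forall c, exists t1 t2, [/\ t = t1 ++ t2, t1 != [::],
      f (s ++ t1) = c & {in s ++ t1 & t2, forall v w, w < v}]}.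
Proof.
elim: cs s u => [|c cs IHcs] s u s_ge stable_su cs_sub; first by exists [::].
have : c \in reachable s u by apply: cs_sub; rewrite mem_head.
rewrite inE => /asboolP[t1 [t1_n0 t1_lt fc]].
have [u' le_u'u st1_ge] := exists_lower_bound (s ++ t1) u.
have eq_reach := stable_su t1 u' le_u'u t1_lt st1_ge.
have lt_u v : v < u' -> v < u by move=> lt_vu'; apply: lt_le_trans le_u'u.
have [||t t_lt t_forest] := IHcs (s ++ t1) u' st1_ge.
- move=> t u'' le_u''u' t_lt; rewrite -catA => st_ge.
  rewrite eq_reach stable_su //; first exact: le_trans le_u'u.
  by rewrite all_cat t1_lt; apply: sub_all t_lt.
- by move=> d cs_d; rewrite eq_reach cs_sub // inE cs_d orbT.
exists (t1 ++ t); first by rewrite all_cat t1_lt; apply: sub_all t_lt.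
move=> d; rewrite inE => /predU1P[-> | cs_d].
  exists t1, t; split=> // v w st1_v t_w.
  exact: lt_le_trans (allP t_lt _ t_w) (allP st1_ge _ st1_v).
have [t3 [t4 [-> t3_n0 fd t34]]] := t_forest d cs_d.
by exists (t1 ++ t3), t4; rewrite !catA in fd t34 *; split=> //; case: (t1) t1_n0.
Qed.

End OnlineColouring.

(** After one exposed rectangle of each reachable colour, the value [u - 1],
    kept free for that purpose, makes a history that is a child of the
    histories ending at each of them. Its own colour is reachable, so it is
    the colour of one of these. *)
Lemma unbounded_chromatic_child : unbounded_chromatic child.
Proof.
move=> K f; have [s [u [s_ge stable_su]]] := exists_stable_state f.
have s_ge' : all (>= (u - 1)%R) s.
  by apply: sub_all s_ge => v /=; lia.
have eq_reach : reachable f s (u - 1) = reachable f s u.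
  by rewrite -{1}[s]cats0; apply: stable_su; rewrite ?cats0 //; lia.
have lt_u v : v < u - 1 -> v < u by lia.
have [||t t_lt t_forest] := exists_forest (f := f) (cs := enum (reachable f s u)) s_ge'.
- move=> t u' le_u' t_lt st_ge; rewrite eq_reach; apply: stable_su => //; first by lia.
  exact: sub_all t_lt.
- by move=> c; rewrite mem_enum eq_reach.
have reach_B : f (s ++ rcons t (u - 1)) \in reachable f s u.
  rewrite inE; apply/asboolP; exists (rcons t (u - 1)); split=> //.
    by case: (t).
  by rewrite all_rcons (sub_all lt_u t_lt) andbT /=; lia.
have [|t1 [t2 [t_eq t1_n0 ft1 t12]]] := t_forest (f (s ++ rcons t (u - 1))).
  by rewrite mem_enum.
exists (s ++ t1), (s ++ rcons t (u - 1)); split=> //.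
apply/asboolP; exists t2, (u - 1); split=> //.
- by case: (s) => //; case: (t1) t1_n0.
- by rewrite t_eq rcons_cat catA.
- rewrite last_cat; apply: (allP t_lt); rewrite t_eq mem_cat.
  by case: (t1) t1_n0 => //= v t1' _; rewrite mem_last.
Qed.

(** * Delayed colours along a chain of histories *)

Section Histories.
Variables (R : realType) (rect : nat -> int -> rectangle R).

Definition rects (x : seq int) : seq (rectangle R) :=
  mkseq (fun i => rect i (nth 0 x i)) (size x).

Definition newest (x : seq int) : rectangle R := rect (size x).-1 (last 0 x).

Lemma rects_rcons x v : rects (rcons x v) = rcons (rects x) (rect (size x) v).
Proof.
rewrite /rects size_rcons mkseqS nth_rcons ltnn eqxx; congr rcons.
by apply/eq_in_map => i; rewrite mem_iota nth_rcons => /andP[_ ->].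
Qed.

Lemma newest_in_rects x y : x != [::] -> prefix x y -> newest x \in rects y.
Proof.
move=> x_n0 /prefixP[t ->]; have x_gt0 : (0 < size x)%N by case: (x) x_n0.
apply/mapP; exists (size x).-1.
  by rewrite mem_iota size_cat add0n leq0n (leq_trans _ (leq_addr _ _)) // prednK.
by rewrite /newest nth_cat prednK // leqnn nth_last.
Qed.

Lemma colour_irrevocable k (presented : pred (seq (rectangle R))) a :
  (forall s, presented (rects s)) -> semi_online (k := k) presented a ->
  forall x y A c, prefix x y -> A \in rects x ->
  a (rects x) A = Some c -> a (rects y) A = Some c.
Proof.
move=> pres online x _ A c /prefixP[t ->] xA col_x.
have sub : forall t, A \in rects (x ++ t).
  elim/last_ind=> [|s v IHs]; first by rewrite cats0.
  by rewrite -rcons_cat rects_rcons mem_rcons inE IHs orbT.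
elim/last_ind: t => [|t v IHt]; first by rewrite cats0.
rewrite -rcons_cat rects_rcons; apply: online => //.
by rewrite -rects_rcons.
Qed.

(** A transitive relation that contains [child], to compare any two histories
    of a chain. *)
Definition extends : rel (seq int) :=
  fun x y => [&& x != [::], prefix x y, (size x < size y)%N & last 0 x < last 0 y].

Lemma extends_trans : transitive extends.
Proof.
move=> y x z /and4P[x0 xy sxy lxy] /and4P[_ yz syz lyz].
rewrite /extends x0 (prefix_trans xy yz) (ltn_trans sxy syz).
by rewrite (lt_trans lxy lyz).
Qed.

Lemma prefix_chain (x z : seq int) (p : seq (seq int)) :
  x != [::] -> path extends x p -> z \in x :: p ->
  (z != [::]) && prefix z (last x p).
Proof.
elim: p x z => [|y p IHp] x z x_n0 /=.
  by rewrite inE => _ /eqP->; rewrite x_n0 prefix_refl.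
case/andP=> /and4P[_ pre_xy sz_xy _] ext_yp.
have y_n0 : y != [::] by case: (y) sz_xy.
rewrite inE => /predU1P[-> | yp_z]; last exact: IHp.
have /andP[_] := IHp y y y_n0 ext_yp (mem_head y p).
by rewrite x_n0; apply: prefix_trans.
Qed.

Lemma child_extends : subrel child extends.
Proof.
move=> x y /asboolP[t [b [x0 -> lt_xb _]]]; rewrite /extends x0 prefix_prefix.
by rewrite last_cat last_rcons lt_xb size_cat size_rcons addnS ltnS leq_addr.
Qed.

(** The pattern of a chain records, for all [i] and [j], the colour at time [j]
    of the [i]-th newest rectangle. When two consecutive windows have the same
    pattern, the colour at the end of the [i]-th rectangle is the one that the
    first rectangle had [i] steps before the end, and the latter keeps its
    colour. *)
Lemma monochromatic_chain k (presented : pred (seq (rectangle R))) a (w : nat) :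
  (forall s, presented (rects s)) -> semi_online (k := k) presented a ->
  exists x p, [/\ path child x p, size p = w, x != [::] &
    forall y z c d, y \in x :: p -> z \in x :: p ->
      a (rects (last x p)) (newest y) = Some c ->
      a (rects (last x p)) (newest z) = Some d -> c = d].
Proof.
move=> pres online.
pose F (q : seq (seq int)) : {ffun 'I_w.+1 * 'I_w.+1 -> option 'I_k} :=
  [ffun ij : 'I_w.+1 * 'I_w.+1 => a (rects (nth [::] q ij.2)) (newest (nth [::] q ij.1))].
have [x [p [y [e_xpy sz_p eqF]]]] :=
  equal_consecutive_windows unbounded_chromatic_child w F.
have [e_xp x_n0] : path child x p /\ x != [::].
  split; first by move: e_xpy; rewrite rcons_path => /andP[].
  by case: (p) e_xpy => [|z q] /= /andP[/asboolP[t [b []]]].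
exists x, p; split=> // {e_xpy}.
pose q := x :: p; pose X i := nth [::] q i.
pose col i j := a (rects (X j)) (newest (X i)).
(* The second window is the first one moved by one step. *)
have shift i j : (i < w)%N -> (j < w)%N -> col i j = col i.+1 j.+1.
  move=> lt_iw lt_jw.
  have := congr1 (fun g : {ffun _ -> _} => g (inord i, inord j)) eqF.
  rewrite !ffunE /= !inordK; try lia.
  by rewrite !nth_rcons sz_p lt_iw lt_jw.
have colE i j : (i + j <= w)%N -> col i (i + j)%N = col 0%N j.
  elim: i => [|i IHi] // le_ijw; rewrite addSn -shift ?IHi //; lia.
have lastE : last x p = X w by rewrite (last_nth [::]) sz_p.
have ext_q : sorted extends q by exact: (sub_path child_extends e_xp).
have colX_w i c : (i <= w)%N -> col i w = Some c -> col 0%N w = Some c.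
  move=> le_iw; rewrite -{1}(subnKC le_iw) colE ?subnKC //.
  have q_wi : X (w - i)%N \in q by rewrite mem_nth //= sz_p ltnS leq_subr.
  have [_ pre] := andP (prefix_chain x_n0 ext_q q_wi).
  rewrite /col -lastE; apply: (colour_irrevocable pres online pre).
  have [-> | lt_iw] := eqVneq i w; first by rewrite subnn newest_in_rects ?prefix_refl.
  have : extends (X 0%N) (X (w - i)%N).
    by apply: (sorted_ltn_nth extends_trans [::] ext_q); rewrite ?inE /= ?sz_p; lia.
  by case/and4P=> ? ? _ _; exact: newest_in_rects.
have colP z c : z \in q -> a (rects (last x p)) (newest z) = Some c -> col 0%N w = Some c.
  move=> q_z; rewrite lastE -(nth_index [::] q_z); apply: colX_w.
  by move: q_z; rewrite -index_mem /= sz_p.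
move=> y1 z c d qy qz /(colP _ _ qy) col_c /(colP _ _ qz).
by rewrite col_c => -[].
Qed.

(** Later values that are not newest in the chain were added below the whole
    history at that time, in particular below the last value of [x]. *)
Lemma dominating_index (x : seq int) (p : seq (seq int)) (i : nat) :
  x != [::] -> path child x p ->
  (i < size (last x p))%N -> ((size x).-1 <= i)%N ->
  last 0 x <= nth 0 (last x p) i ->
  exists2 z, z \in x :: p & rect i (nth 0 (last x p) i) = newest z.
Proof.
move=> x_n0; elim/last_ind: p => [|p y' IHp] /=.
  move=> _ lt_i le_i _; exists x; first exact: mem_head.
  have -> : i = (size x).-1 by lia.
  by rewrite /newest nth_last.
rewrite rcons_path last_rcons => /andP[e_xp].
have last_in : last 0 x \in last x p.
  have /andP[_ /prefixP[t ->]] :=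
    prefix_chain x_n0 (sub_path child_extends e_xp) (mem_head x p).
  by rewrite mem_cat; case: (x) x_n0 => //= v s _; rewrite mem_last.
move=> /asboolP[t [b [y_n0 y'E lt_yb t_lt]]].
rewrite y'E size_cat size_rcons addnS ltnS => le_i ge_i.
rewrite nth_cat; case: ltnP => [lt_i | ge_iy] le_x.
  have [z zP ->] := IHp e_xp lt_i ge_i le_x.
  by exists z => //; move: zP; rewrite !inE mem_rcons inE => /orP[]->; rewrite ?orbT.
move: le_x; rewrite nth_rcons; case: ltnP => [lt_it | ge_it].
  by rewrite leNgt t_lt // mem_nth.
have -> : i = (size (last x p) + size t)%N by lia.
rewrite addKn eqxx => _; exists y'; first by rewrite in_cons mem_rcons -y'E mem_head orbT.
by rewrite /newest y'E size_cat size_rcons addnS last_cat last_rcons.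
Qed.

End Histories.

(** * Increasing steps *)

Section Staircase.
Variable R : realType.

Lemma stair_width i (v : int) : - (i.+1%:R)^-1 <= 2%:R ^ v :> R.
Proof.
by rewrite (le_trans (y := 0)) ?oppr_le0 ?invr_ge0 ?ler0n // exprz_ge0.
Qed.

(** Increasing in [i] are the left-coordinate, which stays negative, and the
    height. Powers of two turn arbitrarily small integers [v] into positive
    right-coordinates, so that the left sides never separate a corner from a
    rectangle. *)
Definition stair i v : rectangle R :=
  @Rectangle R (- (i.+1%:R)^-1) (2%:R ^ v) i%:R (stair_width i v).

Definition corner (A : rectangle R) : R * R := (rightc A, height A).

Lemma region_stair i v j w :
  region (stair j w) (corner (stair i v)) <-> (i <= j)%N /\ v <= w.
Proof.
rewrite /region /corner /= stair_width /= ler_eXz2l ?ltr1n // ler_nat.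
by split=> [[]|[]].
Qed.

Lemma leftc_stair i v j w : (i < j)%N -> leftc (stair i v) < leftc (stair j w).
Proof. by move=> lt_ij; rewrite /= ltrN2 ltf_pV2 ?posrE ?ltr0n // ltr_nat. Qed.

(** The map [phi] is the identity or a reflection. *)
Lemma stairs_ordered (r : rel (rectangle R)) (phi : rectangle R -> rectangle R) x :
  (forall i v j w, (i < j)%N -> r (phi (stair i v)) (phi (stair j w))) ->
  sorted r (map phi (rects stair x)).
Proof.
move=> r_stair; have : sorted ltn (iota 0 (size x)) by exact: iota_ltn_sorted.
rewrite /rects /mkseq -map_comp sorted_map.
by apply: sub_sorted => i j /= lt_ij; apply: r_stair.
Qed.

(** The corner of the first rectangle of a monochromatic chain is covered by
    the chain, which is made of increasing steps, and by nothing else. *)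
Lemma no_increasing_algorithm k m (presented : pred (seq (rectangle R))) :
  (0 < m)%N -> (forall x, presented (rects stair x)) ->
  ~ has_semi_online_algorithm k presented (@increasing_steps R m).
Proof.
case: m => // w _ pres [a [online col]].
have [x [p [e_xp sz_p x_n0 mono]]] := monochromatic_chain w pres online.
pose S (i : 'I_w.+1) := newest stair (nth [::] (x :: p) i).
pose y := last x p.
have srt : sorted extends (x :: p) by exact: (sub_path child_extends e_xp).
have ext (i j : nat) : (i < j <= w)%N ->
    extends (nth [::] (x :: p) i) (nth [::] (x :: p) j).
  move=> lt_ijw.
  by apply: (sorted_ltn_nth extends_trans [::] srt); rewrite ?inE /= ?sz_p; lia.
have covers i : region (S i) (corner (newest stair x)).
  apply/region_stair; case: (posnP i) => [-> // | i_gt0].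
  have /and4P[_ _ sz_lt /ltW] : extends x (nth [::] (x :: p) i).
    by apply: (ext 0%N); have := ltn_ord i; lia.
  by move=> ?; split=> //; lia.
have [] := col (rects stair y) (pres y) (size (rects stair y)) (leqnn _)
               (corner (newest stair x)).
  exists S; split=> //.
    split=> [|i j lt_ij]; first by exists (corner (newest stair x)).
    have := ltn_ord j; rewrite ltnS => le_jw.
    have /and4P[i0 _ sz_lt l_lt] := ext i j (introT andP (conj lt_ij le_jw)).
    have sz_i : (0 < size (nth [::] (x :: p) i))%N by case: nth i0.
    have lt_pred : ((size (nth [::] (x :: p) i)).-1 <
                    (size (nth [::] (x :: p) j)).-1)%N by lia.
    split; first exact: leftc_stair.
      by rewrite /= ltr_eXz2l ?ltr1n.
    by rewrite /= ltr_nat.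
  move=> i; rewrite take_size.
  have /(prefix_chain x_n0 srt)/andP[] : nth [::] (x :: p) i \in x :: p.
    by rewrite mem_nth //= sz_p.
  exact: newest_in_rects.
have newestP A : A \in rects stair y -> region A (corner (newest stair x)) ->
    exists2 z, z \in x :: p & A = newest stair z.
  move=> /mapP[i]; rewrite mem_iota => /andP[_ lt_i] -> /region_stair[le_i le_x].
  exact: dominating_index.
move=> c [d [/eqP c_neq_d [A [yA colA A_p]] [B [yB colB B_p]]]].
rewrite take_size in yA colA yB colB.
have [z1 z1P AE] := newestP A yA A_p; have [z2 z2P BE] := newestP B yB B_p.
by apply: c_neq_d; apply: (mono z1 z2) => //; rewrite -?AE -?BE.
Qed.

End Staircase.

(** * Decreasing steps *)

Section Mirror.
Variable R : realType.

Definition mirror (A : rectangle R) : rectangle R :=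
  @Rectangle R (- rightc A) (- leftc A) (height A)
    (eq_ind_r is_true (leftc_le_rightc A) (lerN2 (rightc A) (leftc A))).

Lemma region_mirror A (p : R * R) : region (mirror A) (- p.1, p.2) <-> region A p.
Proof. by rewrite /region /= !lerN2 andbC. Qed.

(** Reflection reverses the order of left-coordinates, so steps are read
    backwards, and decreasing heights become increasing. *)
Lemma mirror_algorithm k m (presented : pred (seq (rectangle R))) :
  has_semi_online_algorithm k presented (@decreasing_steps R m) ->
  has_semi_online_algorithm k (presented \o map mirror)
    (@increasing_steps R m).
Proof.
move=> [a [online col]]; exists (fun r A => a (map mirror r) (mirror A)).
split=> [s B | s pres_s n le_n p [S [[_ S_incr] S_in S_p]]].
  rewrite /= map_rcons => pres A c sA; apply: online => //; exact: map_f.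
have [||c [d [c_neq_d covc covd]]] := col _ pres_s n _ (- p.1, p.2).
- by rewrite size_map.
- exists (fun i => mirror (S (rev_ord i))); split.
  + split; first by exists (- p.1, p.2) => i; apply/region_mirror.
    move=> i j lt_ij; have [|l r t] := S_incr (rev_ord j) (rev_ord i).
      by rewrite /=; have := ltn_ord j; lia.
    by rewrite /= !ltrN2.
  + by move=> i; rewrite -map_take map_f.
  + by move=> i; apply/region_mirror.
have unmirror e : covered_by_colour (take n (map mirror s))
    (a (take n (map mirror s))) e (- p.1, p.2) ->
    covered_by_colour (take n s) (fun A => a (map mirror (take n s)) (mirror A)) e p.
  rewrite -map_take => -[_ [/mapP[A sA ->] colA /region_mirror A_p]].
  by exists A.
by exists c, d; split=> //; apply: unmirror.
Qed.

End Mirror.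

Theorem corollary3p5 (R : realType) (k m : nat) (hk : (0 < k)%N) (hm : (0 < m)%N) :
  (~ has_semi_online_algorithm k (@from_left R) (@increasing_steps R m) /\
   ~ has_semi_online_algorithm k (@from_below R) (@increasing_steps R m)) /\
  (~ has_semi_online_algorithm k (@from_right R) (@decreasing_steps R m) /\
   ~ has_semi_online_algorithm k (@from_below R) (@decreasing_steps R m)).
Proof.
split; split.
- apply: no_increasing_algorithm => // x; rewrite -[rects _ _]map_id.
  by apply: stairs_ordered => i v j w; apply: leftc_stair.
- apply: no_increasing_algorithm => // x; rewrite -[rects _ _]map_id.
  by apply: stairs_ordered => i v j w /= ?; rewrite ltr_nat.
- move=> /mirror_algorithm; apply: no_increasing_algorithm => // x.
  apply: stairs_ordered => i v j w lt_ij /=; rewrite ltrN2.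
  exact: (@leftc_stair R i v j w).
- move=> /mirror_algorithm; apply: no_increasing_algorithm => // x.
  by apply: stairs_ordered => i v j w /= ?; rewrite ltr_nat.
Qed.
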